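(* Let $(X,\mathcal{B})$ be a tree-like ball space. Then $(X,\mathrm{cu}(\mathcal{B}))$ is tree-like and chain union closed. Furthermore, if $(X,\mathcal{B})$ is spherically complete, then so is $(X,\mathrm{cu}(\mathcal{B}))$.
   Context: A ball space $(X,\mathcal{B})$ is a nonempty set $X$ together with a nonempty collection $\mathcal{B}$ of nonempty subsets of $X$ (called balls). A chain in $\mathcal{B}$ is a nonempty subset of $\mathcal{B}$ that is linearly ordered by inclusion. The ball space is spherically complete if every chain in $\mathcal{B}$ has nonempty intersection. Define $\mathrm{cu}(\mathcal{B})=\{\bigcup\mathcal{C}\mid \emptyset\ne\mathcal{C}\subseteq\mathcal{B},\ \mathcal{C}\text{ is a chain}\}$. The ball space is chain union closed if $\mathrm{cu}(\mathcal{B})=\mathcal{B}$. It is tree-like if for all $B_1,B_2\in\mathcal{B}$, $B_1\cap B_2\neq\emptyset$ implies $B_1\subseteq B_2$ or $B_2\subseteq B_1$. *)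

(* Defs.v *)
From mathcomp Require Import all_boot.
From mathcomp Require Import boolp classical_sets.

Set Implicit Arguments.
Unset Strict Implicit.
Unset Printing Implicit Defensive.

Local Open Scope classical_set_scope.

(* The underlying set of a ball space is a whole type X. *)

Definition ball_space (X : Type) (B : set (set X)) : Prop :=
  [/\ [set: X] !=set0, B !=set0 & forall A, B A -> A !=set0].

Definition chain (X : Type) (B C : set (set X)) : Prop :=
  [/\ C !=set0, C `<=` B & total_on C subset].

Definition spherically_complete (X : Type) (B : set (set X)) : Prop :=
  forall C, chain B C -> \bigcap_(A in C) A !=set0.

Definition cu (X : Type) (B : set (set X)) : set (set X) :=
  [set \bigcup_(A in C) A | C in chain B].

Definition chain_union_closed (X : Type) (B : set (set X)) : Prop :=
  cu B = B.

Definition tree_like (X : Type) (B : set (set X)) : Prop :=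
  forall B1 B2, B B1 -> B B2 ->
    B1 `&` B2 !=set0 -> B1 `<=` B2 \/ B2 `<=` B1.

(* Main.v *)
Require Import Defs.
From mathcomp Require Import all_boot.
From mathcomp Require Import boolp classical_sets.

(** In a tree-like ball space, a nonempty set is a union of a chain of balls as
    soon as any two of its points lie in a common ball contained in it: the
    balls inside it through a fixed point form a chain. This turns tree-likeness
    and chain union closedness of [cu B] into statements about pairs of points.
    If a chain [E] in [cu B] has no least element, then between any two members
    [V] properly included in [U] there is a ball; the balls containing some
    member of [E] form a chain, whose intersection is contained in that of [E]. *)

Local Open Scope classical_set_scope.

Lemma sub_cu {X : Type} {B : set (set X)} : B `<=` cu B.
Proof.
move=> A BA; exists [set A]; last exact: bigcup_set1.
split; [by exists A | by move=> _ -> | by move=> _ _ -> ->; left].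
Qed.

Lemma total_on_pair {X : Type} {C : set (set X)} {U V : set X} {x y : X} :
  total_on C subset -> C U -> C V -> U x -> V y ->
  exists W, [/\ C W, W x & W y].
Proof.
move=> Ctot CU CV Ux Vy.
by case: (Ctot U V CU CV) => UV; [exists V|exists U]; split=> //; apply: UV.
Qed.

Lemma cu_pair {X : Type} {B : set (set X)} {U : set X} {x y : X} :
  cu B U -> U x -> U y -> exists b, [/\ B b, b x, b y & b `<=` U].
Proof.
move=> [C [_ CB Ctot] <-] [b1 Cb1 b1x] [b2 Cb2 b2y].
have [b [Cb bx bY]] := total_on_pair Ctot Cb1 Cb2 b1x b2y.
by exists b; split=> //; [exact: CB | exact: bigcup_sup].
Qed.

Lemma cu_nonempty {X : Type} {B : set (set X)} {U : set X} :
  ball_space B -> cu B U -> U !=set0.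
Proof.
move=> [_ _ Bne] [C [[A CA] CB _] <-].
by have [x Ax] := Bne A (CB A CA); exists x, A.
Qed.

Lemma ball_space_cu {X : Type} {B : set (set X)} :
  ball_space B -> ball_space (cu B).
Proof.
move=> HB; case: (HB) => Xne [A BA] _; split=> //.
  by exists A; apply: sub_cu.
by move=> U; apply: cu_nonempty.
Qed.

Lemma tree_like_cu_intro {X : Type} {B : set (set X)} {U : set X} {x : X} :
  tree_like B -> U x ->
  (forall y, U y -> exists b, [/\ B b, b x, b y & b `<=` U]) -> cu B U.
Proof.
move=> HT Ux HU; exists [set b | [/\ B b, b x & b `<=` U]].
  split.
  - by have [b [Bb bx _ bU]] := HU x Ux; exists b.
  - by move=> b [].
  - by move=> b c [Bb bx _] [Bc cx _]; apply: HT => //; exists x.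
apply/seteqP; split=> [y [b [_ _ bU] bY]|y Uy]; first exact: bU.
by have [b [Bb bx bY bU]] := HU y Uy; exists b.
Qed.

(** Any [z] in [V] shares with [x] a ball [c] inside [V]. Both [c] and [b] contain [x], and [c]
    cannot include [b] because [y] is outside [V]; so [c], and with it [z], lies in [b]. *)
Lemma cu_between {X : Type} {B : set (set X)} {V b : set X} {x y : X} :
  tree_like B -> cu B V -> B b -> V x -> b x -> b y -> ~ V y -> V `<=` b.
Proof.
move=> HT cV Bb Vx bx bY nVy z Vz.
have [c [Bc cx cz cV']] := cu_pair cV Vx Vz.
have cbx : c `&` b !=set0 by exists x.
case: (HT c b Bc Bb cbx) => [cb|bc]; first exact: cb.
by case: nVy; apply/cV'/bc.
Qed.

Lemma tree_like_cu {X : Type} {B : set (set X)} :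
  tree_like B -> tree_like (cu B).
Proof.
move=> HT U V cU cV [x [Ux Vx]].
have [VU|/existsNP[y /not_implyP[Vy nUy]]] := pselect (V `<=` U); first by right.
(* The point [y] of [V] outside [U] gives a ball [b] with [U] inside [b] inside [V]. *)
left; have [b [Bb bx bY bV]] := cu_pair cV Vx Vy.
by apply: subset_trans bV; apply: (cu_between HT cU Bb Ux bx bY nUy).
Qed.

Lemma chain_union_closed_cu {X : Type} {B : set (set X)} :
  ball_space B -> tree_like B -> chain_union_closed (cu B).
Proof.
move=> HB HT; apply/seteqP; split; last exact: sub_cu.
move=> W cW; have [x Wx] := cu_nonempty (ball_space_cu HB) cW.
apply: (tree_like_cu_intro HT Wx) => y Wy.
(* [cu_pair] is used at two levels: first with [cu B] as the family of balls, then with [B]. *)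
have [U [cU Ux Uy UW]] := cu_pair cW Wx Wy.
have [b [Bb bx bY bU]] := cu_pair cU Ux Uy.
by exists b; split=> //; apply: subset_trans UW.
Qed.

Lemma spherically_complete_cu {X : Type} {B : set (set X)} :
  ball_space B -> tree_like B ->
  spherically_complete B -> spherically_complete (cu B).
Proof.
move=> HB HT HS E [[U0 EU0] EB Etot].
have [[M [EM Mleast]]|noleast] :=
  pselect (exists M, E M /\ forall U, E U -> M `<=` U).
  by have [x Mx] := cu_nonempty HB (EB M EM); exists x => U EU; apply: Mleast.
pose C := [set b | B b /\ exists2 V, E V & V `<=` b].
have ballE U : E U -> exists2 b, C b & b `<=` U.
  move=> EU.
  (* As [U] is not least, some [V] in [E] does not include it; by totality [V] is then properly
     included in [U], which leaves room for a ball between them. *)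
  have [V [EV nUV]] : exists V, E V /\ ~ U `<=` V.
    apply: contrapT => H; apply: noleast; exists U; split=> // V EV.
    by apply: contrapT => nUV; apply: H; exists V.
  have VU : V `<=` U by case: (Etot U V EU EV).
  have /existsNP[y /not_implyP[Uy nVy]] := nUV.
  have [x Vx] := cu_nonempty HB (EB V EV).
  have [b [Bb bx bY bU]] := cu_pair (EB U EU) (VU x Vx) Uy.
  exists b => //; split=> //; exists V => //.
  exact: cu_between HT (EB V EV) Bb Vx bx bY nVy.
have chC : chain B C.
  split; [by have [b Cb _] := ballE U0 EU0; exists b | by move=> b [] |].
  (* The smaller of [V] and [W] lies in both [b] and [c] and is nonempty, so the two balls meet and
     are comparable. *)
  move=> b c [Bb [V EV Vb]] [Bc [W EW Wc]]; apply: HT => //.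
  have [x Vx] := cu_nonempty HB (EB V EV).
  have [y Wy] := cu_nonempty HB (EB W EW).
  case: (Etot V W EV EW) => VW.
    by exists x; split; [exact: Vb | apply/Wc/VW].
  by exists y; split; [apply/Vb/VW | exact: Wc].
have [p Cp] := HS C chC; exists p => U EU.
by have [b Cb bU] := ballE U EU; exact: bU (Cp b Cb).
Qed.

Theorem theorem4p1 (X : Type) (B : set (set X))
    (HB : ball_space B) (HT : tree_like B) :
  (ball_space (cu B) /\ tree_like (cu B) /\ chain_union_closed (cu B)) /\
  (spherically_complete B -> spherically_complete (cu B)).
Proof.
split; last exact: spherically_complete_cu HB HT.
split; first exact: ball_space_cu HB.
by split; [exact: tree_like_cu HT | exact: chain_union_closed_cu HB HT].
Qed.
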